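(* The set $$\Phi=\{\varphi_i\mid 0\le i\le p-r\}\cup\{\psi_j\mid j\in J\}\cup\{\theta\}\cup\{\xi_{i,j}\mid 1\le i\le j\le p-1\}$$ is a minimal Groebner basis for the ideal $P$ with respect to the grevlex monomial order with $x_0<x_1<\cdots<x_n$ and with the grading $wt(x_i)=m_i$.
   Context: Setting. Let $K$ be a field, $n\ge 2$ an integer, $p=n-1$. Let $m_0,\dots,m_p$ be an arithmetic sequence of positive integers with $0<m_0<\cdots<m_p$, let $m_n$ be an arbitrary positive integer, and assume $\gcd(m_0,\dots,m_n)=1$. Let $\mathbb N_0=\{0,1,2,\dots\}$, $\Gamma=\sum_{i=0}^n\mathbb N_0m_i$, $\Gamma'=\sum_{i=0}^p\mathbb N_0m_i$. Assume $\Gamma$ is minimally generated by $m_0,\dots,m_n$. Let $P$ be the kernel of the $K$-algebra homomorphism $\eta:K[x_0,\dots,x_n]\to K[t]$, $\eta(x_i)=t^{m_i}$. For integers $a,b$ let $[a,b]=\{t\in\mathbb Z\mid a\le t\le b\}$ (empty if $a>b$). For an integer $t\ge0$ define $q_t\in\mathbb Z$, $r_t\in[1,p]$ and $g_t$ by $t=q_tp+r_t$ and $g_t=q_tm_p+m_{r_t}$ (so $q_0=-1$, $r_0=p$, $g_0=0$). Parameters. Let $S=\{\gamma\in\Gamma\mid\gamma-m_0\notin\Gamma\}$, $u=\min\{t\ge0\mid g_t\notin S\}$, $\upsilon=\min\{b\ge1\mid bm_n\in\Gamma'\}$. By a known lemma of Patil and Singh there exist unique integers $w\in[0,\upsilon-1]$,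 $z\in[0,u-1]$, $\lambda\ge1$, $\mu\ge0$, $\nu\ge2$ such that (i) $g_u=\lambda m_0+wm_n$; (ii) $\upsilon m_n=\mu m_0+g_z$; (iii) $g_{u-z}+(\upsilon-w)m_n=\nu m_0$, where $\nu=\lambda+\mu+1$ if $r_{u-z}<r_u$ and $\nu=\lambda+\mu$ if $r_{u-z}\ge r_u$. Put $q=q_u$, $r=r_u$, $q'=q_{u-z}$, $r'=r_{u-z}$, $V=[0,u-1]\times[0,\upsilon-1]$, $W=[u-z,u-1]\times[\upsilon-w,\upsilon-1]$. Let $J=\emptyset$ if $W=\emptyset$, and $J=[0,\min(z-1,p-r')]$ if $W\neq\emptyset$. Binomials. $\varphi_i=x_{r+i}x_p^{q}-x_0^{\lambda-1}x_ix_n^{w}$ for $0\le i\le p-r$; $\psi_j=x_{r'+j}x_p^{q'}x_n^{\upsilon-w}-x_0^{\nu-1}x_j$ for $j\in J$; $\theta=x_n^{\upsilon}-x_0^{\mu}x_{r_z}x_p^{q_z}$ (where for $z=0$ one reads $x_{r_z}x_p^{q_z}=x_px_p^{-1}=1$); for $1\le i\le j\le p-1$: $\xi_{i,j}=x_ix_j-x_0x_{i+j}$ if $i+j\le p$, and $\xi_{i,j}=x_ix_j-x_{i+j-p}x_p$ if $i+j>p$. Monomial order. Monomials are compared first by weighted degree $\sum a_im_i$; for equal weighted degree, $\prod_{i=0}^n x_i^{a_i}>\prod_{i=0}^n x_i^{b_i}$ if the left-most nonzero entry of $(a_0-b_0,\dots,a_n-b_n)$ is negative. (For each binomial above the first written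 monomial is the leading one.) A minimal Groebner basis of an ideal is a Groebner basis $G$ such that every $f\in G$ has leading coefficient $1$ and, for all $f\in G$, the leading monomial $LM(f)$ is not in the ideal generated by the leading monomials of the elements of $G\setminus\{f\}$. *)

(* Defs.v *)
From HB Require Import structures.
From mathcomp Require Export all_boot all_order all_algebra.
From mathcomp.multinomials Require Export mpoly.

Set Implicit Arguments.
Unset Strict Implicit.
Unset Printing Implicit Defensive.

Import Order.TTheory GRing.Theory Num.Theory.

Local Open Scope ring_scope.

Definition is_least (A : nat -> Prop) (k : nat) : Prop :=
  A k /\ forall j : nat, A j -> (k <= j)%N.

(* The integer interval [a, b], for b >= 0; empty when a > b. *)
Definition iv (a b : nat) : seq nat := iota a (b.+1 - a).

Definition ideal_gen (R : comNzRingType) (A : R -> Prop) (f : R) : Prop :=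
  exists s : seq (R * R),
    (forall c, c \in s -> A c.2) /\ f = \sum_(c <- s) c.1 * c.2.

(* [le] is the reflexive version of a monomial order, so 1 is its least
   monomial. Subsets of the polynomial ring are predicates; finite subsets are
   sequences, whose order and repetitions play no role. *)
Section Groebner.

Context (K : fieldType) (k : nat) (le : rel 'X_{1..k}).

Implicit Types (f g : {mpoly K[k]}) (I : {mpoly K[k]} -> Prop).
Implicit Type G : seq {mpoly K[k]}.

(* Exponent of the leading monomial; junk value 0 at f = 0. *)
Definition lexp f : 'X_{1..k} :=
  \big[(fun a b => if le a b then b else a)/0%MM]_(a <- msupp f) a.

Definition LM f : {mpoly K[k]} := 'X_[lexp f].

Definition LC f : K := f@_(lexp f).

Definition LMs I : {mpoly K[k]} -> Prop :=
  fun h => exists f, [/\ I f, f != 0 & h = LM f].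

Definition groebner_basis I G : Prop :=
  (forall g, g \in G -> I g) /\
  (forall h, ideal_gen (LMs (fun g => g \in G)) h <-> ideal_gen (LMs I) h).

Definition minimal_groebner_basis I G : Prop :=
  groebner_basis I G /\
  forall f, f \in G ->
    LC f = 1 /\ ~ ideal_gen (LMs (fun g => g \in G /\ g <> f)) (LM f).

End Groebner.

Definition wt (k : nat) (m : nat -> nat) (a : 'X_{1..k}) : nat :=
  (\sum_(i < k) a i * m i)%N.

(* For equal weights, a < b iff the left-most nonzero entry of a - b is
   positive. *)
Definition wgrevlex_lt (k : nat) (m : nat -> nat) (a b : 'X_{1..k}) : bool :=
  (wt m a < wt m b)%N ||
  (wt m a == wt m b) &&
    [exists i : 'I_k, (b i < a i)%N && [forall j : 'I_k, (j < i)%N ==> (a j == b j)]].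

Definition wgrevlex (k : nat) (m : nat -> nat) : rel 'X_{1..k} :=
  fun a b => (a == b) || wgrevlex_lt m a b.

(* Only the values m 0, ..., m n of m are ever used. Semigroups are subsets of
   the integers, so that gamma - m_0 needs no truncation. *)
Definition sgen (n : nat) (m : nat -> nat) (A : {set 'I_n.+1}) (x : int) : Prop :=
  exists a : 'I_n.+1 -> nat, x = (\sum_(i in A) a i * m i)%N%:Z.

Definition Gamma (n : nat) (m : nat -> nat) : int -> Prop :=
  sgen m [set: 'I_n.+1].

Definition Gamma' (n : nat) (m : nat -> nat) : int -> Prop :=
  sgen m [set i : 'I_n.+1 | (i <= n.-1)%N].

Definition minimally_generated (n : nat) (m : nat -> nat) : Prop :=
  forall A : {set 'I_n.+1}, A \proper [set: 'I_n.+1] ->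
    ~ (forall x : int, sgen m A x <-> Gamma n m x).

Definition Sset (n : nat) (m : nat -> nat) (x : int) : Prop :=
  Gamma n m x /\ ~ Gamma n m (x - (m 0%N)%:Z).

(* The unique q and r in [1, p] with t = q p + r: see [qr_eq], [rt_bounds]. *)
Definition qt (p t : nat) : int := ((t%:Z - 1) %/ p%:Z)%Z.

Definition rt (p t : nat) : nat := `|((t%:Z - 1) %% p%:Z)%Z|%N.+1.

Definition gseq (p : nat) (m : nat -> nat) (t : nat) : int :=
  qt p t * (m p)%:Z + (m (rt p t))%:Z.

Lemma qr_eq (p t : nat) : (0 < p)%N -> t%:Z = qt p t * p%:Z + (rt p t)%:Z.
Proof.
move=> p0; rewrite /qt /rt -addn1 PoszD gez0_abs; last first.
  by rewrite modz_ge0 // -lt0n.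
by rewrite addrA -divz_eq subrK.
Qed.

Lemma rt_bounds (p t : nat) : (0 < p)%N -> (1 <= rt p t <= p)%N.
Proof.
move=> p0; rewrite /rt /= -ltz_nat gez0_abs; first by rewrite ltz_pmod.
by rewrite modz_ge0 // -lt0n.
Qed.

Lemma qt0 (p : nat) : (0 < p)%N -> qt p 0 = -1.
Proof. by case: p => // p _; rewrite /qt /= sub0r divNz_nat // div.div0n. Qed.

Lemma qt_ge0 (p t : nat) : (0 < p)%N -> (0 < t)%N -> 0 <= qt p t.
Proof.
by move=> p0 t0; rewrite /qt divz_ge0 ?ltz_nat // subr_ge0 lez_nat.
Qed.

Definition toric_ideal (K : fieldType) (n : nat) (m : nat -> nat)
    (f : {mpoly K[n.+1]}) : Prop :=
  mmap (@polyC K) (fun i : 'I_n.+1 => 'X^(m i)) f = 0.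

Section Binomials.

Context (K : fieldType) (n : nat) (u v w z lambda mu nu : nat).

(* Only used with i <= n. *)
Definition x (i : nat) : {mpoly K[n.+1]} := 'X_(inord i).

Let p := n.-1.

(* q_t as a natural exponent; only used for t > 0, where q_t >= 0. *)
Definition qexp (t : nat) : nat := `|qt p t|%N.

Definition phi (i : nat) : {mpoly K[n.+1]} :=
  x (rt p u + i) * x p ^+ qexp u - x 0 ^+ lambda.-1 * x i * x n ^+ w.

Definition psi (j : nat) : {mpoly K[n.+1]} :=
  x (rt p (u - z) + j) * x p ^+ qexp (u - z) * x n ^+ (v - w)
  - x 0 ^+ nu.-1 * x j.

Definition theta : {mpoly K[n.+1]} :=
  x n ^+ v
  - x 0 ^+ mu * (if z == 0%N then 1 else x (rt p z) * x p ^+ qexp z).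

Definition xi (i j : nat) : {mpoly K[n.+1]} :=
  if (i + j <= p)%N then x i * x j - x 0 * x (i + j)
  else x i * x j - x (i + j - p) * x p.

Definition W : seq (nat * nat) :=
  [seq (a, b) | a <- iv (u - z) u.-1, b <- iv (v - w) v.-1].

(* When W is nonempty, z > 0, so z.-1 is not truncated. *)
Definition J : seq nat :=
  if W == [::] then [::] else iv 0 (minn z.-1 (p - rt p (u - z))).

Definition Phi : seq {mpoly K[n.+1]} :=
  [seq phi i | i <- iv 0 (p - rt p u)] ++ [seq psi j | j <- J]
  ++ [:: theta] ++ [seq xi i j | i <- iv 1 p.-1, j <- iv i p.-1].

End Binomials.

(* Main.v *)
Require Import Defs.
From mathcomp Require Import all_boot all_order all_algebra.
From mathcomp.multinomials Require Import mpoly.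
From mathcomp Require Import zify.

(** Why [Phi] is a minimal Groebner basis of the toric ideal.

    All elements of [Phi] are differences of two monomials of equal weight, so
    they lie in the ideal, and the argument takes place among monomials.  Call
    a monomial standard if no leading monomial of [Phi] divides it.  Subtracting
    a leading exponent and adding the corresponding trailing one moves every
    monomial down to a standard one of the same weight
    ([standard_below]).  If [f] is in the ideal, the coefficients of the
    monomials of [f] that have the weight of its leading monomial add up to
    zero, so [f] contains a smaller monomial of that weight
    ([toric_lexp_lower]).  Hence, as soon as a standard monomial is determined
    by its weight, the leading monomial of [f] cannot be standard, which is the
    Groebner property; minimality says that the leading monomials form an
    antichain for divisibility ([toric_minimal_groebner]).

    The leading monomials of the [xi] leave only the monomials
    [x_0^k * X_t * x_n^b], where [X_t = x_(r_t) * x_p^(q_t)] has weight [g_t]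
    ([stair_form]).  The leading monomials of [theta], [phi] and [psi] then say
    [b < v], [t < u] and that [(t, b)] is not in [W], respectively
    ([standard_form]).

    It remains to recover [(k, t, b)] from [k m_0 + g_t + b m_n]
    ([box_injective]).  With [d] the common difference, [g_t] is [t d] up to a
    multiple of [m_0], so two such triples of equal weight give a pair [(e, f)]
    of differences with [e d + f m_n] divisible by [m_0].  If [e] and [f] have
    opposite signs or one of them is zero, [g_|e|] and [|f| m_n] differ by a multiple of [m_0], and the
    minimality of [u] (when [g_|e|] is the larger) or that of [v] (otherwise)
    forces [e = f = 0] ([no_opposite_relation]).  If [e, f > 0], subtracting
    [(e, f)] from the relations [(u, -w)] and [(-z, v)] yields pairs of the
    former kind unless [u - z <= e] and [v - w <= f] ([relation_in_W]), and then
    one of the two triples lies over [W].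

    The antichain property rests on [q_u >= 1], which holds because [q_u = 0]
    would make the generator [m_u] a combination of [m_0] and [m_n]
    ([lt_p_u]). *)

Import Order.TTheory GRing.Theory Num.Theory.
Local Open Scope ring_scope.

Set Implicit Arguments.
Unset Strict Implicit.
Unset Printing Implicit Defensive.

(** * Weights of exponents *)

Section Weight.
Variables (k : nat) (m : nat -> nat).
Implicit Types (a b c : 'X_{1..k}).

Lemma wt0 : wt m (0%MM : 'X_{1..k}) = 0%N.
Proof. by rewrite /wt big1 // => i _; rewrite mnm0E. Qed.

Lemma wtD a b : wt m (a + b)%MM = (wt m a + wt m b)%N.
Proof.
by rewrite /wt -big_split /=; apply: eq_bigr => i _; rewrite mnmDE mulnDl.
Qed.

Lemma wtMn a j : wt m (a *+ j)%MM = (j * wt m a)%N.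
Proof.
by rewrite /wt big_distrr /=; apply: eq_bigr => i _; rewrite mulmnE mulnAC mulnC.
Qed.

Lemma wtU (i : 'I_k) : wt m U_(i)%MM = m i.
Proof.
rewrite /wt (bigD1 i) //= mnm1E eqxx mul1n big1 ?addn0 // => j ji.
by rewrite mnm1E eq_sym (negbTE ji).
Qed.

Lemma wt_le a b : (a <= b)%MM -> (wt m a <= wt m b)%N.
Proof. by move/mnm_lepP=> ab; apply: leq_sum => i _; rewrite leq_mul2r ab orbT. Qed.

End Weight.

(** * The weighted reverse lexicographic order *)

Section Order.
Variables (k : nat) (m : nat -> nat).
Implicit Types (a b c : 'X_{1..k}).

Lemma wgrevlex_ltP a b :
  reflect (wt m a < wt m b \/ wt m a = wt m b /\
           exists2 i : 'I_k, b i < a i & forall j : 'I_k, j < i -> a j = b j)%N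
    (wgrevlex_lt m a b).
Proof.
apply: (iffP orP) => -[lt_ab|]; try by left.
  case/andP=> /eqP eq_ab /existsP[i /andP[ltba /forallP eqj]]; right; split=> //.
  by exists i => // j ji; apply/eqP; move: (eqj j); rewrite ji.
case=> eq_ab [i ltba eqj]; right; rewrite eq_ab eqxx /=; apply/existsP; exists i.
by rewrite ltba; apply/forallP => j; apply/implyP => ji; rewrite eqj.
Qed.

Lemma wgrevlex_lt_irr a : wgrevlex_lt m a a = false.
Proof.
by apply/negP => /wgrevlex_ltP[|[_ [i]]]; rewrite ltnn.
Qed.

Lemma wgrevlex_lt_trans b a c :
  wgrevlex_lt m a b -> wgrevlex_lt m b c -> wgrevlex_lt m a c.
Proof.
case/wgrevlex_ltP=> [ab|[ab [i iab jab]]] /wgrevlex_ltP[bc|[bc [i' ibc jbc]]];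
  apply/wgrevlex_ltP; try by left; lia.
right; split; first by rewrite ab.
have [ii|ii|/val_inj ii] := ltngtP i i'.
- exists i => [|j ji]; first by rewrite -jbc.
  by rewrite jab // jbc // (ltn_trans ji).
- exists i' => [|j ji]; first by rewrite jab.
  by rewrite jab ?jbc // (ltn_trans ji).
- rewrite -ii in ibc jbc; exists i => [|j ji]; first exact: ltn_trans ibc iab.
  by rewrite jab // jbc.
Qed.

Lemma wgrevlex_lt_total a b : a != b -> wgrevlex_lt m a b || wgrevlex_lt m b a.
Proof.
move=> neq; have [lt|lt|eq_wt] := ltngtP (wt m a) (wt m b).
- by apply/orP; left; apply/wgrevlex_ltP; left.
- by apply/orP; right; apply/wgrevlex_ltP; left.
have /existsP[i0 i0P] : [exists i, a i != b i].
  rewrite -negb_forall; apply: contra neq => /forallP eqab.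
  by apply/eqP/mnmP => i; apply/eqP.
have [i ineq imin] := @arg_minnP _ i0 (fun i => a i != b i) (@nat_of_ord k) i0P.
have eqj (j : 'I_k) : (j < i)%N -> a j = b j.
  by move=> ji; apply/eqP; apply: contraLR ji => /imin; rewrite -leqNgt.
have [lt|lt|eqi] := ltngtP (a i) (b i); last by rewrite eqi eqxx in ineq.
- apply/orP; right; apply/wgrevlex_ltP; right; split=> //.
  by exists i => // j /eqj ->.
- by apply/orP; left; apply/wgrevlex_ltP; right; split=> //; exists i.
Qed.

Lemma wgrevlex_lt_add c a b :
  wgrevlex_lt m a b -> wgrevlex_lt m (c + a)%MM (c + b)%MM.
Proof.
case/wgrevlex_ltP=> [ab|[ab [i iab jab]]]; apply/wgrevlex_ltP; rewrite !wtD.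
  by left; lia.
right; split; first by rewrite ab.
exists i => [|j ji]; rewrite !mnmDE; first by rewrite ltn_add2l.
by rewrite jab.
Qed.

Lemma wgrevlex_refl : reflexive (@wgrevlex k m).
Proof. by move=> a; rewrite /wgrevlex eqxx. Qed.

Lemma wgrevlex_trans : transitive (@wgrevlex k m).
Proof.
move=> b a c /orP[/eqP->//|ab] /orP[/eqP<-|bc]; first by apply/orP; right.
by rewrite /wgrevlex (wgrevlex_lt_trans ab bc) orbT.
Qed.

Lemma wgrevlex_anti : antisymmetric (@wgrevlex k m).
Proof.
move=> a b /andP[/orP[/eqP//|ab] /orP[/eqP//|ba]].
by have := wgrevlex_lt_trans ab ba; rewrite wgrevlex_lt_irr.
Qed.

Lemma wgrevlex_total : total (@wgrevlex k m).
Proof.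
move=> a b; rewrite /wgrevlex; case: eqVneq => //= neq.
exact: wgrevlex_lt_total.
Qed.

Hypothesis m_gt0 : forall i : 'I_k, (0 < m i)%N.

Lemma mdeg_le_wt a : (mdeg a <= wt m a)%N.
Proof. by rewrite mdegE; apply: leq_sum => i _; rewrite leq_pmulr. Qed.

Lemma wgrevlex_0 a : wgrevlex m 0%MM a.
Proof.
have [->|a0] := eqVneq a 0%MM; first exact: wgrevlex_refl.
apply/orP; right; apply/wgrevlex_ltP; left; rewrite wt0.
by apply: leq_trans (mdeg_le_wt a); rewrite lt0n mdeg_eq0.
Qed.

(** Only finitely many exponents share a given weight, since all weights are
    positive; hence the order is well-founded on each of these classes. *)
Lemma wgrevlex_lt_ind (P : 'X_{1..k} -> Prop) :
  (forall a, (forall b, wt m b = wt m a -> wgrevlex_lt m b a -> P b) -> P a) ->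
  forall a, P a.
Proof.
move=> IH a0.
(* The measure is the number of exponents below [a] of degree at most the weight. *)
pose below a := [set b : 'X_{1..k < (wt m a0).+1} | wgrevlex_lt m b a].
suff H N : forall a, wt m a = wt m a0 -> (#|below a| < N)%N -> P a.
  exact: H (ltnSn _).
elim: N => // N IHN a wa card_a; apply: IH => b wb ba.
apply: IHN => [|]; first by rewrite wb.
rewrite -ltnS; apply: leq_trans card_a; rewrite ltnS; apply: proper_card.
have bB : (mdeg b < (wt m a0).+1)%N by rewrite ltnS -wa -wb mdeg_le_wt.
apply/properP; split; last by exists (BMultinom bB); rewrite !inE //= wgrevlex_lt_irr.
by apply/subsetP => c; rewrite !inE => cb; apply: wgrevlex_lt_trans cb ba.
Qed.

End Order.

(** * Leading exponents and monomial ideals *)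

Section Leading.
Variables (K : fieldType) (k : nat) (le : rel 'X_{1..k}).
Hypotheses (le_refl : reflexive le) (le_trans : transitive le).
Hypotheses (le_anti : antisymmetric le) (le_total : total le).
Hypothesis le0 : forall a, le 0%MM a.
Implicit Types (f g : {mpoly K[k]}) (a b : 'X_{1..k}).

Lemma foldr_max (s : seq 'X_{1..k}) (op := fun a b => if le a b then b else a) :
  (foldr op 0%MM s \in 0%MM :: s) /\ forall b, b \in s -> le b (foldr op 0%MM s).
Proof.
elim: s => [|a s [IHin IHle]] /=; first by rewrite inE eqxx.
rewrite {1 3}/op; case: ifP => [le_a|/negbT nle]; split.
- by move: IHin; rewrite !inE => /orP[->|->] //; rewrite !orbT.
- by move=> b; rewrite inE => /orP[/eqP->//|/IHle].
- by rewrite !inE eqxx orbT.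
- have {}nle : le (foldr op 0%MM s) a by case/orP: (le_total a (foldr op 0%MM s)) nle => [->|].
  by move=> b; rewrite inE => /orP[/eqP->//|/IHle /le_trans]; apply.
Qed.

Lemma lexpE f : lexp le f = foldr (fun a b => if le a b then b else a) 0%MM (msupp f).
Proof. by rewrite /lexp unlock; elim: (msupp f) => //= a s ->. Qed.

Lemma lexp_ge f b : b \in msupp f -> le b (lexp le f).
Proof. by rewrite lexpE => bf; apply: (foldr_max _).2. Qed.

Lemma lexp_eq f a :
  a \in msupp f -> (forall b, b \in msupp f -> le b a) -> lexp le f = a.
Proof.
move=> af amax; apply: le_anti; rewrite lexp_ge // andbT lexpE.
have [] := foldr_max (msupp f); rewrite inE => /orP[/eqP->|/amax//] _.
exact: le0.
Qed.

Lemma lexp_supp f : f != 0 -> lexp le f \in msupp f.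
Proof.
move=> f0; have := (foldr_max (msupp f)).1; rewrite -lexpE inE => /orP[/eqP lf|//].
case E: (msupp f) => [|a s]; first by move: f0; rewrite -msupp_eq0 E.
have af : a \in msupp f by rewrite E mem_head.
have := lexp_ge af; rewrite lf => a0.
by rewrite -E (_ : 0%MM = a) //; apply: le_anti; rewrite le0 a0.
Qed.

(** The coefficient of [a] in a combination of monomials vanishes unless one of
    these monomials divides [a]. *)
Lemma ideal_gen_monomial_dvd (A : {mpoly K[k]} -> Prop) a :
  ideal_gen (LMs le A) 'X_[a] -> exists2 f, A f & (lexp le f <= a)%MM.
Proof.
case=> s [sA aE].
have : (\sum_(c <- s) c.1 * c.2)@_a != 0 by rewrite -aE mcoeffX eqxx oner_neq0.
rewrite raddf_sum /= => nz.
have [c cs ca] : exists2 c, c \in s & (c.1 * c.2)@_a != 0.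
  apply/hasP; apply: contraNT nz => /hasPn cs0; rewrite big_seq big1 // => c.
  by move/cs0; rewrite negbK => /eqP.
have [f [Af f0 cE]] := sA _ cs; exists f => //.
move: ca; rewrite cE -mcoeff_msupp (perm_mem (msuppMX _ _)) => /mapP[b _ ->].
exact: lem_addr.
Qed.

End Leading.

(** Monomial ideals are compared through divisibility of single generators, so
    principal multiples suffice in the hypothesis. *)
Lemma ideal_gen_trans (R : comNzRingType) (A B : R -> Prop) :
  (forall f, A f -> exists2 g, B g & exists c, f = c * g) ->
  forall h, ideal_gen A h -> ideal_gen B h.
Proof.
move=> AB h [s [sA ->]]; elim: s sA => [|[c f] s IH] sA.
  by exists [::]; rewrite !big_nil.
have [|t [tB tE]] := IH; first by move=> d ds; apply: sA; rewrite inE ds orbT.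
have [g Bg [d fE]] := AB f (sA (c, f) (mem_head _ _)).
exists ((c * d, g) :: t); rewrite !big_cons tE /= fE mulrA; split=> //.
by move=> e; rewrite inE => /orP[/eqP->|/tB].
Qed.

(** * Groebner bases of binomials in a toric ideal *)

Section Criterion.
Variables (K : fieldType) (n : nat) (m : nat -> nat).
Hypothesis m_gt0 : forall i : 'I_n.+1, (0 < m i)%N.
Notation mon := 'X_{1..n.+1}.
Implicit Types (a b : mon) (f : {mpoly K[n.+1]}) (c : mon * mon).

Let le0 := wgrevlex_0 m_gt0.
Let le_total := @wgrevlex_total n.+1 m.
Let le_refl := @wgrevlex_refl n.+1 m.
Let le_anti := @wgrevlex_anti n.+1 m.
Let le_trans := @wgrevlex_trans n.+1 m.

(** A pair of exponents stands for a binomial, the first one being meant to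
    lead; this avoids recovering the two monomials from the polynomial. *)
Definition binom c : {mpoly K[n.+1]} := 'X_[c.1] - 'X_[c.2].

Definition lowering c := wt m c.1 = wt m c.2 /\ wgrevlex_lt m c.2 c.1.

Definition standard (s : seq (mon * mon)) a := forall c, c \in s -> ~~ (c.1 <= a)%MM.

Lemma lowering_neq c : lowering c -> c.1 != c.2.
Proof. by case=> _; apply: contraTneq => ->; rewrite wgrevlex_lt_irr. Qed.

Lemma lexp_binom c : lowering c -> lexp (wgrevlex m) (binom c) = c.1.
Proof.
move=> cl; have neq := lowering_neq cl; have [_ lt] := cl.
apply: lexp_eq => //.
  rewrite mcoeff_msupp mcoeffB !mcoeffX eqxx [c.2 == _]eq_sym (negbTE neq).
  by rewrite subr0 oner_neq0.
move=> b; rewrite mcoeff_msupp mcoeffB !mcoeffX.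
case: (eqVneq c.1 b) => [<- _|_]; first exact: le_refl.
case: (eqVneq c.2 b) => [<- _|_]; last by rewrite subrr eqxx.
by rewrite /wgrevlex lt orbT.
Qed.

Lemma LC_binom c : lowering c -> LC (wgrevlex m) (binom c) = 1.
Proof.
move=> cl; rewrite /LC lexp_binom // mcoeffB !mcoeffX eqxx [c.2 == _]eq_sym.
by rewrite (negbTE (lowering_neq cl)) subr0.
Qed.

Lemma toric_mmap1 a :
  mmap1 (fun i : 'I_n.+1 => 'X^(m i) : {poly K}) a = 'X^(wt m a).
Proof.
rewrite /mmap1 /wt (big_morph (fun i => 'X^i : {poly K}) (exprD 'X) (expr0 _)).
by apply: eq_bigr => i _; rewrite -exprM mulnC.
Qed.

Lemma toric_binom c : lowering c -> toric_ideal m (binom c).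
Proof. by case=> cw _; rewrite /toric_ideal mmapB !mmapX !toric_mmap1 cw subrr. Qed.

(** In the image of [f], the coefficient of degree the weight of the leading
    exponent is the sum of the coefficients of [f] over that weight class.  It
    vanishes, so the leading term is not alone in its class. *)
Lemma toric_lexp_lower f : f != 0 -> toric_ideal m f ->
  exists2 b, wt m b = wt m (lexp (wgrevlex m) f)
    & wgrevlex_lt m b (lexp (wgrevlex m) f).
Proof.
set a := lexp _ f => f0 If.
have af : a \in msupp f by apply: lexp_supp.
have /hasP[b bf /andP[ba /eqP wb]] :
    has (fun b => (b != a) && (wt m b == wt m a)) (msupp f).
  apply: contraT => /hasPn no.
  have /eqP := congr1 (fun P : {poly K} => P`_(wt m a)) If.
  rewrite coef0 coef_sum (bigD1_seq a) //= big_seq_cond big1.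
    rewrite toric_mmap1 coefCM coefXn eqxx mulr1 addr0 => /eqP fa.
    by move: af; rewrite mcoeff_msupp fa eqxx.
  move=> b /andP[/no nb ba]; rewrite toric_mmap1 coefCM coefXn.
  by move: nb; rewrite ba /= eq_sym => /negbTE->; rewrite mulr0.
exists b => //; have /orP[/eqP bE|//] := lexp_ge le_refl le_trans le_total bf.
by rewrite bE eqxx in ba.
Qed.

(** Division by the binomials of [s], done on a single monomial: it stays a
    monomial and keeps its weight, and the descent is well-founded. *)
Lemma standard_below s a : (forall c, c \in s -> lowering c) ->
  exists b, [/\ wt m b = wt m a, wgrevlex m b a & standard s b].
Proof.
move=> sl; elim/(wgrevlex_lt_ind m_gt0): a => a IH.
have [/hasP[c cs ca]|/hasPn std] := boolP (has (fun c => (c.1 <= a)%MM) s); last first.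
  by exists a; split=> //; apply: le_refl.
have [cw clt] := sl c cs.
set a' := (a - c.1 + c.2)%MM.
have wa' : wt m a' = wt m a by rewrite -[in RHS](submK ca) !wtD cw.
have lt_a' : wgrevlex_lt m a' a by rewrite -[X in _ _ X](submK ca) wgrevlex_lt_add.
have [b [wb ba' std]] := IH a' wa' lt_a'.
exists b; split=> //; first by rewrite wb.
by apply: le_trans ba' _; rewrite /wgrevlex lt_a' orbT.
Qed.

(** A standard leading exponent of an element of the ideal would have a smaller
    exponent of the same weight, hence a smaller standard one, against the
    injectivity of the weight on standard exponents. *)
Lemma toric_minimal_groebner s :
  (forall c, c \in s -> lowering c) ->
  (forall a b, standard s a -> standard s b -> wt m a = wt m b -> a = b) ->
  (forall c c', c \in s -> c' \in s -> (c.1 <= c'.1)%MM -> c = c') ->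
  minimal_groebner_basis (wgrevlex m) (toric_ideal m) (map binom s).
Proof.
move=> sl std_inj anti.
have sI g : g \in map binom s -> toric_ideal m g.
  by case/mapP=> c /sl cl ->; apply: toric_binom.
split; first split=> // h; first split.
- apply: ideal_gen_trans => _ [g [gs g0 ->]].
  exists (LM (wgrevlex m) g); last by exists 1; rewrite mul1r.
  by exists g; split=> //; apply: sI.
- apply: ideal_gen_trans => _ [f [If f0 ->]].
  have [b wb lt_b] := toric_lexp_lower f0 If.
  set a := lexp _ f in wb lt_b *.
  have [/hasP[c cs ca]|/hasPn std_a] := boolP (has (fun c => (c.1 <= a)%MM) s); last first.
    have [b' [wb' le_b' std_b']] := standard_below b sl.
    have ab' : a = b' by apply: std_inj => //; rewrite wb' wb.
    have := le_b'; rewrite -ab' /wgrevlex => /orP[/eqP ab|ab].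
      by rewrite ab wgrevlex_lt_irr in lt_b.
    by have := wgrevlex_lt_trans ab lt_b; rewrite wgrevlex_lt_irr.
  exists 'X_[c.1]; last by exists 'X_[a - c.1]; rewrite -mpolyXD submK.
  exists (binom c); split; [exact: map_f| |by rewrite /LM lexp_binom //; apply: sl].
  by apply: contraNneq (oner_neq0 K) => c0; rewrite -(LC_binom (sl c cs)) c0 /LC mcoeff0.
move=> _ /mapP[c cs ->]; split; first exact: LC_binom (sl c cs).
rewrite /LM lexp_binom; last exact: sl.
case/ideal_gen_monomial_dvd=> _ [/mapP[c' c's ->]] neq.
rewrite lexp_binom; last exact: sl.
by move/(anti _ _ c's cs) => eqc; case: neq; rewrite eqc.
Qed.

End Criterion.

(** * The monomials attached to the sequence of the g_t *)

Section Staircase.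
Variable n : nat.
Notation p := n.-1.
Notation mon := 'X_{1..n.+1}.
Implicit Types (a b : mon) (f m : nat -> nat).

Definition var i : mon := U_(inord i)%MM.

Lemma var_entry i j : (i <= n)%N -> (j <= n)%N -> var i (inord j) = (i == j).
Proof. by move=> ni nj; rewrite mnm1E -val_eqE /= !inordK. Qed.

Lemma wt_var f i : (i <= n)%N -> wt f (var i) = f i.
Proof. by move=> ni; rewrite wtU inordK. Qed.

Lemma mnm_entriesP a b :
  (forall j, (j <= n)%N -> a (inord j) = b (inord j)) -> a = b.
Proof. by move=> ab; apply/mnmP => j; rewrite -(inord_val j) ab -1?ltnS. Qed.

Lemma mnm_le_entriesP a b :
  (forall j, (j <= n)%N -> a (inord j) <= b (inord j))%N -> (a <= b)%MM.
Proof. by move=> ab; apply/mnm_lepP => j; rewrite -(inord_val j) ab -1?ltnS. Qed.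

Lemma mnm_le_entry a b j : (a <= b)%MM -> (a (inord j) <= b (inord j))%N.
Proof. by move/mnm_lepP. Qed.

Lemma lowering_of_entry m i (c : mon * mon) : (i <= n)%N -> wt m c.1 = wt m c.2 ->
  (c.1 (inord i) < c.2 (inord i))%N ->
  (forall j, (j < i)%N -> c.1 (inord j) = c.2 (inord j)) -> lowering m c.
Proof.
move=> ni cw lt eqj; split=> //; apply/wgrevlex_ltP; right; split=> //.
exists (inord i) => // j; rewrite inordK // -[j in c.2 j]inord_val => /eqj <-.
by rewrite inord_val.
Qed.

Hypothesis n_ge2 : (2 <= n)%N.

Lemma qexp_rt t : (0 < t)%N -> t = (qexp n t * p + rt p t)%N.
Proof.
have p0 : (0 < p)%N by lia.
move=> t0; have := qr_eq t p0; rewrite -{1}(gez0_abs (qt_ge0 p0 t0)) => /eqP.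
by rewrite -PoszM -PoszD eqz_nat => /eqP.
Qed.

Lemma rtP t : (1 <= rt p t <= p)%N.
Proof. by apply: rt_bounds; lia. Qed.

Lemma qexp_rt_unique q r : (0 < r <= p)%N ->
  qexp n (q * p + r) = q /\ rt p (q * p + r) = r.
Proof.
move=> rp; have t0 : (0 < q * p + r)%N by rewrite addn_gt0 orbC; case/andP: rp => ->.
have := qexp_rt t0; have := rtP (q * p + r).
set q' := qexp _ _; set r' := rt _ _ => r'p E.
suff qq : q' = q by split=> //; rewrite qq in E; lia.
by have [lt|lt|//] := ltngtP q' q; nia.
Qed.

(** The exponent of [x_(r_t) * x_p^(q_t)], which is 1 for [t = 0], where
    [q_0 = -1] and [r_0 = p]. *)
Definition stair t : mon :=
  if t == 0%N then 0%MM else (var (rt p t) + var p *+ qexp n t)%MM.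

(** The weight for which [stair t] has weight [t]; it recovers [t] from the
    monomial and bounds divisibility between two of them. *)
Definition height i := if (i <= p)%N then i else 0%N.

Lemma stairE q r : (0 < r <= p)%N -> stair (q * p + r)%N = (var r + var p *+ q)%MM.
Proof.
move=> rp; have [qE rE] := qexp_rt_unique q rp.
by rewrite /stair qE rE addn_eq0 [r == 0%N]gtn_eqF ?andbF //; case/andP: rp.
Qed.

Lemma stair_height t : wt height (stair t) = t.
Proof.
rewrite /stair; case: eqP => [->|/eqP]; first exact: wt0.
rewrite -lt0n => t0; have rp := rtP t.
rewrite wtD wtMn !wt_var; [|lia..]; rewrite /height leqnn.
by case/andP: rp => _ ->; rewrite [RHS](qexp_rt t0) addnC.
Qed.

Lemma stair_wt m t : gseq p m t = (wt m (stair t))%:Z.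
Proof.
have p0 : (0 < p)%N by lia.
have rp := rtP t; rewrite /gseq /stair; case: eqP => [->|/eqP].
  rewrite wt0 qt0 // mulN1r; suff -> : rt p 0 = p by rewrite addNr.
  have := qr_eq 0 p0; rewrite qt0 // mulN1r => /esym/eqP.
  by rewrite addrC subr_eq0 eqz_nat => /eqP.
rewrite -lt0n => t0; rewrite wtD wtMn !wt_var; [|lia..].
by rewrite -(gez0_abs (qt_ge0 p0 t0)) -PoszM -PoszD addnC.
Qed.

(** If [q_s = q_t], then the two monomials coincide for [j = t - s]; if
    [q_s < q_t], already [x_p^(q_s + 1)], which is [j = p - r_s], divides. *)
Lemma stair_dvd s t : (0 < s <= t)%N ->
  exists j : nat, [/\ (s + j <= t)%N, (j <= p - rt p s)%N &
    (var (rt p s + j) + var p *+ qexp n s <= stair t)%MM].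
Proof.
move=> /andP[s0 st]; have t0 : (0 < t)%N by lia.
have [rs rt'] := (rtP s, rtP t).
have [sE tE] := (qexp_rt s0, qexp_rt t0).
have -> : stair t = (var (rt p t) + var p *+ qexp n t)%MM by rewrite /stair; case: eqP => //; lia.
have [lt|lt|eqq] := ltngtP (qexp n s) (qexp n t).
- exists (p - rt p s)%N; split=> //; first by nia.
  rewrite subnKC; last lia.
  apply: mnm_le_entriesP => j nj; rewrite !mnmDE !mulmnE !var_entry; [|lia..].
  by case: eqP => _; lia.
- by exfalso; nia.
- exists (t - s)%N; split; [lia|rewrite eqq in sE; lia|].
  rewrite (_ : rt p s + (t - s) = rt p t)%N ?eqq ?lepm_refl //.
  by rewrite eqq in sE; lia.
Qed.

Definition xi_pair i j : mon * mon :=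
  (var i + var j,
   if (i + j <= p)%N then var 0 + var (i + j) else var (i + j - p) + var p)%MM.

(** An exponent divisible by no [x_i * x_j] with [1 <= i <= j < p] involves at
    most one of [x_1, ..., x_(p - 1)], and this one with exponent 1. *)
Lemma stair_form a :
  (forall i j, (1 <= i <= j)%N -> (j <= p.-1)%N -> ~~ ((xi_pair i j).1 <= a)%MM) ->
  a = (var 0 *+ a (inord 0) + stair (wt height a) + var n *+ a (inord n))%MM.
Proof.
move=> nxi.
suff [t aE] : exists t,
    a = (var 0 *+ a (inord 0) + stair t + var n *+ a (inord n))%MM.
  suff -> : wt height a = t by [].
  rewrite aE !wtD !wtMn stair_height !wt_var //= /height leq0n muln0.
  by rewrite ifN ?muln0 ?addn0 //; lia.
have [/existsP[i /andP[ip ai]]|] :=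
    boolP [exists i : 'I_n.+1, (1 <= i <= p.-1)%N && (0 < a i)%N].
  exists (a (inord p) * p + i)%N; rewrite stairE; last lia.
  have ai1 : a (inord i) = 1%N.
    rewrite inord_val; apply/eqP; rewrite eqn_leq ai andbT leqNgt.
    apply/negP => ai2; have := nxi i i; rewrite leqnn andbT => /(_ _ _)/negP[]; try lia.
    apply: mnm_le_entriesP => j nj; rewrite mnmDE !var_entry; [|lia..].
    by case: eqP => // <-; rewrite inord_val.
  apply: mnm_entriesP => j nj.
  rewrite !mnmDE !mulmnE !var_entry; [|lia..].
  have [->|j0] := eqVneq j 0%N; first by lia.
  have [->|jn] := eqVneq j n; first by lia.
  have [->|jp] := eqVneq j p; first by lia.
  have [->|ji] := eqVneq j i; first by lia.
  suff : a (inord j) = 0%N by lia.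
  apply/eqP; rewrite -leqn0 leqNgt; apply/negP => aj.
  have := nxi (minn i j) (maxn i j) => /(_ _ _)/negP[]; try lia.
  apply: mnm_le_entriesP => k nk; rewrite mnmDE !var_entry; [|lia..].
  have [kE|ki] := eqVneq k i; first by rewrite kE inord_val; lia.
  by have [->|kj] := eqVneq k j; lia.
rewrite negb_exists => /forallP none.
have mid j : (1 <= j <= p.-1)%N -> a (inord j) = 0%N.
  by move=> jp; have := none (inord j); rewrite inordK; lia.
case ap: (a (inord p)) => [|q].
  exists 0%N; apply: mnm_entriesP => j nj.
  rewrite !mnmDE !mulmnE mnm0E !var_entry; [|lia..].
  have [->|j0] := eqVneq j 0%N; first lia.
  have [->|jn] := eqVneq j n; first by lia.
  have [->|jp] := eqVneq j p; first by lia.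
  by rewrite mid; lia.
exists (q * p + p)%N; rewrite stairE; last lia.
apply: mnm_entriesP => j nj.
rewrite !mnmDE !mulmnE !var_entry; [|lia..].
have [->|j0] := eqVneq j 0%N; first lia.
have [->|jn] := eqVneq j n; first by lia.
have [->|jp] := eqVneq j p; first by lia.
by rewrite mid; lia.
Qed.

End Staircase.

(** * Semigroups as sets of weights *)

Section Semigroup.
Variables (n : nat) (m : nat -> nat).
Notation p := n.-1.
Implicit Types (a : 'X_{1..n.+1}).
Hypothesis n_ge2 : (2 <= n)%N.

Lemma sgen_wt (A : {set 'I_n.+1}) a :
  (forall i, i \notin A -> a i = 0%N) -> sgen m A (wt m a)%:Z.
Proof.
move=> aA; exists (fun i => a i); rewrite [in RHS]big_mkcond /wt.
by congr (_%:Z); apply: eq_bigr => i _; case: ifPn => // /aA ->.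
Qed.

Lemma Gamma_wt a : Gamma n m (wt m a)%:Z.
Proof. by apply: sgen_wt => i; rewrite inE. Qed.

Lemma Gamma'_wt a : a (inord n) = 0%N -> Gamma' n m (wt m a)%:Z.
Proof.
move=> an; apply: sgen_wt => i; rewrite inE => ip.
have iE : nat_of_ord i = n by have := ltn_ord i; lia.
by rewrite -(inord_val i) iE.
Qed.

Lemma sgenP (A : {set 'I_n.+1}) x : sgen m A x ->
  exists2 a, x = (wt m a)%:Z & forall i, i \notin A -> a i = 0%N.
Proof.
case=> a ->; exists [multinom if i \in A then a i else 0%N | i < n.+1].
  rewrite big_mkcond /wt; congr (_%:Z); apply: eq_bigr => i _.
  by rewrite mnmE; case: ifP.
by move=> i iA; rewrite mnmE (negbTE iA).
Qed.

(** Substituting [a] for the [i]-th generator removes it from any combination,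
    so it would be superfluous. *)
Lemma minimally_generated_not_relation (i : nat) a : minimally_generated n m ->
  (i <= n)%N -> a (inord i) = 0%N -> wt m a != m i.
Proof.
move=> m_min ni ai; apply/eqP => wa.
apply: (m_min [set~ inord i]).
  by rewrite properT; apply/eqP => /setP/(_ (inord i)); rewrite !inE eqxx.
move=> x; split=> /sgenP[b -> b0]; first exact: Gamma_wt.
pose k := b (inord i); pose b' := (b - var n i *+ k)%MM.
have bE : b = (b' + var n i *+ k)%MM.
  rewrite submK //; apply: mnm_le_entriesP => j nj.
  by rewrite mulmnE var_entry //; case: eqP => [<-|]; rewrite ?mul1n.
have -> : wt m b = wt m (b' + a *+ k)%MM by rewrite bE !wtD !wtMn wa wt_var.
apply: sgen_wt => j; rewrite !inE negbK => /eqP->.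
by rewrite mnmDE mnmBE !mulmnE var_entry // eqxx ai mul1n subnn.
Qed.

(** For [u <= p] the weight of [stair u] would be the generator [m_u]. *)
Lemma lt_p_u u lambda w : minimally_generated n m -> (0 < u)%N ->
  wt m (stair n u) = (lambda * m 0 + w * m n)%N -> (p < u)%N.
Proof.
move=> m_min u_gt0 eq_u; rewrite ltnNge; apply/negP => up.
have stE : stair n u = var n u.
  have := @stairE n n_ge2 0 u; rewrite u_gt0 up => /(_ isT).
  by rewrite mul0n add0n mulm0n addm0.
have un : (u <= n)%N by lia.
have nu0 : (var n 0 *+ lambda + var n n *+ w)%MM (inord u) = 0%N.
  by rewrite mnmDE !mulmnE !var_entry; lia.
have /eqP := minimally_generated_not_relation m_min un nu0; apply.
by rewrite wtD !wtMn !wt_var // -eq_u stE wt_var.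
Qed.

End Semigroup.

(** * Weights determine the box coordinates *)

Section Apery.
Variables (n : nat) (m : nat -> nat) (d u v w z lambda mu : nat).
Notation p := n.-1.
Notation mon := 'X_{1..n.+1}.
Hypotheses (n_ge2 : (2 <= n)%N) (m0_gt0 : (0 < m 0)%N).
Hypothesis m_arith : forall i, (i <= p)%N -> m i = (m 0 + i * d)%N.

(** The degree of [stair t], that is [q_t + 1]. *)
Definition rows t := wt (fun i => (i <= p)%N : nat) (stair n t).

Lemma stair_entry_n t : stair n t (inord n) = 0%N.
Proof.
have := rtP n_ge2 t; rewrite /stair; case: eqP => _ rp; first by rewrite mnm0E.
by rewrite mnmDE mulmnE !var_entry; lia.
Qed.

(** Along an arithmetic sequence, the weight only depends on the degree and on
    the height. *)
Lemma wt_arith (a : mon) : a (inord n) = 0%N ->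
  wt m a = (wt (fun i => (i <= p)%N : nat) a * m 0 + wt (height n) a * d)%N.
Proof.
move=> an; rewrite /wt !big_distrl -big_split /=; apply: eq_bigr => i _.
rewrite /height; case: leqP => [ip|ip]; first by rewrite (m_arith ip); lia.
have iE : nat_of_ord i = n by have := ltn_ord i; lia.
by rewrite -(inord_val i) iE an.
Qed.

Lemma wt_stair t : wt m (stair n t) = (rows t * m 0 + t * d)%N.
Proof. by rewrite wt_arith ?stair_entry_n // stair_height. Qed.

Lemma rows_gt0 t : (0 < t)%N -> (0 < rows t)%N.
Proof.
have rp := rtP n_ge2 t.
by rewrite /rows /stair; case: eqP => [->//|_ _]; rewrite wtD wt_var; lia.
Qed.

Hypothesis u_def : is_least (fun t => ~ Sset n m (gseq p m t)) u.
Hypothesis v_def : is_least (fun b => (1 <= b)%N /\ Gamma' n m (b * m n)%N%:Z) v.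

(** By the relation, [g_e] and [f m_n] differ by a multiple of [m_0].  If [g_e]
    is larger, then [g_e - m_0] is in the semigroup and [u <= e]; otherwise
    [f m_n] is a combination of [m_0, ..., m_p], so [v <= f] unless [f = 0]. *)
Lemma no_opposite_relation e f k k' : (e < u)%N -> (f < v)%N ->
  (e * d + k * m 0 = f * m n + k' * m 0)%N -> e = 0%N /\ f = 0%N.
Proof.
move=> eu fv rel; have wE := wt_stair e.
have [lt|ge] := ltnP k (rows e + k').
  suff : (u <= e)%N by lia.
  apply: u_def.2 => -[_]; apply.
  rewrite stair_wt //.
  pose c := (rows e + k' - k).-1.
  have -> : (wt m (stair n e))%:Z - (m 0)%:Z = (wt m (var n n *+ f + var n 0 *+ c)%MM)%:Z.
    rewrite wtD !wtMn !wt_var //.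
    have kE : (rows e + k' = k + c.+1)%N by rewrite /c; lia.
    have := congr1 (muln^~ (m 0)) kE; rewrite !mulnDl mulSn.
    by lia.
  exact: Gamma_wt.
pose c := (k - (rows e + k'))%N.
have kE : (k = rows e + k' + c)%N by rewrite /c; lia.
have fE : (f * m n = wt m (stair n e + var n 0 *+ c)%MM)%N.
  by rewrite wtD wtMn wt_var // wE; move: rel; rewrite kE; lia.
have f0 : f = 0%N.
  apply/eqP; rewrite -leqn0 leqNgt; apply/negP => f_gt0.
  suff : (v <= f)%N by lia.
  apply: v_def.2; split=> //; rewrite fE; apply: Gamma'_wt => //.
  by rewrite mnmDE mulmnE stair_entry_n var_entry; lia.
split=> //; apply/eqP; rewrite -leqn0 leqNgt; apply/negP => /rows_gt0.
move: fE; rewrite f0 wtD wE; have := m0_gt0; nia.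
Qed.

Hypotheses (w_lt : (w < v)%N) (z_lt : (z < u)%N).
Hypothesis eq_u : wt m (stair n u) = (lambda * m 0 + w * m n)%N.
Hypothesis eq_v : (v * m n)%N = (mu * m 0 + wt m (stair n z))%N.

(** Adding [(z, -v)], respectively subtracting from [(u, -w)], turns [(e, f)]
    into a relation between components of opposite signs, small enough for
    [no_opposite_relation] if the claimed bound fails. *)
Lemma relation_in_W e f k k' : (0 < e < u)%N -> (0 < f < v)%N ->
  (e * d + f * m n + k * m 0 = k' * m 0)%N -> (u - z <= e)%N /\ (v - w <= f)%N.
Proof.
move=> /andP[e0 eu] /andP[f0 fv] rel; have := eq_u; have := eq_v.
rewrite !wt_stair => eqv equ; split; rewrite leqNgt; apply/negP => lt.
  have := @no_opposite_relation (z + e) (v - f) (mu + rows z + k) k'.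
  by case; lia.
have := @no_opposite_relation (u - e) (w + f) (rows u + k') (lambda + k).
by case; lia.
Qed.

(** The difference of two points of the box is either of the kind excluded by
    [no_opposite_relation] or of the kind described by [relation_in_W]; in the
    latter case the larger point dominates the difference, so it is in [W]. *)
Lemma box_injective t s b c k k' :
  (t < u)%N -> (s < u)%N -> (b < v)%N -> (c < v)%N ->
  ~ ((u - z <= t)%N /\ (v - w <= b)%N) -> ~ ((u - z <= s)%N /\ (v - w <= c)%N) ->
  (k * m 0 + wt m (stair n t) + b * m n = k' * m 0 + wt m (stair n s) + c * m n)%N ->
  [/\ t = s, b = c & k = k'].
Proof.
wlog st : t s b c k k' / (s <= t)%N.
  move=> H; have [le|lt] := leqP s t; first exact: H.
  move=> tu su bv cv tW sW rel.
  by have [] := H s t c b k' k (ltnW lt) su tu cv bv sW tW (esym rel).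
move=> tu su bv cv tW sW rel.
suff [ts bc] : t = s /\ b = c.
  split=> //; move: rel; rewrite ts bc => /addIn/addIn/eqP.
  by rewrite eqn_pmul2r // => /eqP.
move: rel; rewrite !wt_stair => rel.
have [e tE] : exists e, t = (s + e)%N by exists (t - s)%N; lia.
have [bc|cb] := leqP b c.
  have [f cE] : exists f, c = (b + f)%N by exists (c - b)%N; lia.
  have := @no_opposite_relation e f (k + rows t) (k' + rows s).
  by case; lia.
have [f bE] : exists f, b = (c + f)%N by exists (b - c)%N; lia.
have [e0|e0] := eqVneq e 0%N.
  have := @no_opposite_relation 0 f (k' + rows s) (k + rows t).
  by case; lia.
have := @relation_in_W e f (k + rows t) (k' + rows s).
by case; lia.
Qed.

End Apery.

(** * The exponents of the binomials of Phi *)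

Section Binomials.
Variables (n u v w z lambda mu nu : nat).
Notation p := n.-1.
Notation mon := 'X_{1..n.+1}.
Notation var := (var n).
Notation r := (rt p u).
Notation q := (qexp n u).
Notation r' := (rt p (u - z)).
Notation q' := (qexp n (u - z)).

Definition phi_pair i : mon * mon :=
  (var (r + i) + var p *+ q, var 0 *+ lambda.-1 + var i + var n *+ w)%MM.

Definition psi_pair j : mon * mon :=
  (var (r' + j) + var p *+ q' + var n *+ (v - w), var 0 *+ nu.-1 + var j)%MM.

Definition theta_pair : mon * mon := (var n *+ v, var 0 *+ mu + stair n z)%MM.

Definition Phi_pairs : seq (mon * mon) :=
  [seq phi_pair i | i <- iv 0 (p - r)] ++ [seq psi_pair j | j <- J n u v w z]
  ++ [:: theta_pair] ++ [seq xi_pair n i j | i <- iv 1 p.-1, j <- iv i p.-1].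

Lemma Phi_binom (K : fieldType) :
  Phi K n u v w z lambda mu nu = map (@binom K n) Phi_pairs.
Proof.
rewrite /Phi /Phi_pairs !map_cat -!map_comp map_allpairs.
congr (_ ++ (_ ++ ([:: _] ++ _))).
- by apply: eq_map => i; rewrite /binom /= !mpolyXD -!mpolyXn.
- by apply: eq_map => j; rewrite /binom /= !mpolyXD -!mpolyXn.
- rewrite /binom /theta /= mpolyXD -!mpolyXn /stair; congr (_ - _ * _).
  by case: eqP => _; rewrite ?mpolyX0 // mpolyXD -mpolyXn.
- apply: eq_allpairs => i j; rewrite /binom /xi /xi_pair.
  by case: ifP => _; rewrite /= !mpolyXD.
Qed.

Hypotheses (n_ge2 : (2 <= n)%N) (w_lt : (w < v)%N) (z_lt : (z < u)%N).

(** [W] is empty exactly when [z] or [w] vanishes. *)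
Lemma mem_J j : (j \in J n u v w z) = [&& 0 < w, j < z & j <= p - r']%N.
Proof.
have zE : (u.-1.+1 - (u - z))%N = z by lia.
have wE : (v.-1.+1 - (v - w))%N = w by lia.
rewrite /J /W -size_eq0 size_allpairs !size_iota zE wE muln_eq0.
have [->|z0] := eqVneq z 0%N; first by rewrite in_nil ltn0 andbF.
have [->|w0] := eqVneq w 0%N; first by rewrite in_nil.
by rewrite /= mem_iota; lia.
Qed.

Lemma Phi_pairs_ind (P : mon * mon -> Prop) :
  (forall i, (i <= p - r)%N -> P (phi_pair i)) ->
  (forall j, (0 < w)%N -> (j < z)%N -> (j <= p - r')%N -> P (psi_pair j)) ->
  P theta_pair ->
  (forall i j, (1 <= i <= j)%N -> (j <= p.-1)%N -> P (xi_pair n i j)) ->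
  forall c, c \in Phi_pairs -> P c.
Proof.
move=> Pphi Ppsi Ptheta Pxi c; rewrite !mem_cat.
case/or4P=> [/mapP[i]|/mapP[j]|/predU1P[->|]//|/allpairsPdep[i [j []]]].
- by rewrite mem_iota => ip ->; apply: Pphi; lia.
- by rewrite mem_J => /and3P[w0 jz jp] ->; apply: Ppsi.
by rewrite !mem_iota => ip jp ->; apply: Pxi; lia.
Qed.

Lemma phi_pair_in i : (i <= p - r)%N -> phi_pair i \in Phi_pairs.
Proof. by move=> ip; rewrite mem_cat map_f // mem_iota; lia. Qed.

Lemma psi_pair_in j : (0 < w)%N -> (j < z)%N -> (j <= p - r')%N ->
  psi_pair j \in Phi_pairs.
Proof. by move=> w0 jz jp; rewrite !mem_cat map_f ?orbT // mem_J w0 jz. Qed.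

Lemma theta_pair_in : theta_pair \in Phi_pairs.
Proof. by rewrite !mem_cat mem_head !orbT. Qed.

Lemma xi_pair_in i j : (1 <= i <= j)%N -> (j <= p.-1)%N ->
  xi_pair n i j \in Phi_pairs.
Proof.
move=> ij jp; rewrite !mem_cat; apply/or4P/Or44/allpairsPdep.
by exists i, j; rewrite !mem_iota; split=> //; lia.
Qed.

Let u_gt0 : (0 < u)%N. Proof. by lia. Qed.
Let u'_gt0 : (0 < u - z)%N. Proof. by lia. Qed.

Lemma stair_pos t : (0 < t)%N ->
  stair n t = (var (rt p t) + var p *+ qexp n t)%MM.
Proof. by rewrite /stair lt0n => /negbTE->. Qed.

Lemma phi_pair_dvd t : (u <= t)%N ->
  exists2 i, (i <= p - r)%N & ((phi_pair i).1 <= stair n t)%MM.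
Proof.
by move=> ut; have [|i [_ ip le]] := @stair_dvd n n_ge2 u t; [lia|exists i].
Qed.

(** The leading monomials of [phi], [theta] and [psi] bound [t], bound [b] and
    exclude [W]; for [phi] and [psi], [stair_dvd] supplies the member of the
    family that divides. *)
Lemma standard_form (a : mon) : standard Phi_pairs a -> exists k t b,
  [/\ a = (var 0 *+ k + stair n t + var n *+ b)%MM, (t < u)%N, (b < v)%N &
      ~ ((u - z <= t)%N /\ (v - w <= b)%N)].
Proof.
move=> std.
have aE := stair_form n_ge2 (fun i j ij jp => std _ (xi_pair_in ij jp)).
set t := wt _ a in aE.
have stair_le : (stair n t <= a)%MM.
  by rewrite [X in (_ <= X)%MM]aE; apply/mnm_lepP => i; rewrite !mnmDE; lia.
have tu : (t < u)%N.
  rewrite ltnNge; apply/negP => /phi_pair_dvd[i ip le_i].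
  by have /negP := std _ (phi_pair_in ip); apply; apply: lepm_trans stair_le.
have bv : (a (inord n) < v)%N.
  rewrite ltnNge; apply/negP => vb; have /negP := std _ theta_pair_in; apply.
  apply: mnm_le_entriesP => j nj; rewrite mulmnE var_entry //.
  by case: eqP => [<-|] //; rewrite mul1n.
exists (a (inord 0)), t, (a (inord n)); split=> // -[ut vb].
have [|j [jt jp le_j]] := @stair_dvd n n_ge2 (u - z) t; first lia.
have w0 : (0 < w)%N by lia.
have jz : (j < z)%N by lia.
have /negP := std _ (psi_pair_in w0 jz jp); apply.
rewrite [X in (_ <= X)%MM]aE; apply/mnm_lepP => i.
have := mnm_lepP le_j i; rewrite /= !(mnmDE, mulmnE) => le_ji.
have : ((v - w) * var n i <= a (inord n) * var n i)%N by rewrite leq_mul2r vb orbT.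
by lia.
Qed.

Lemma qexp_u_gt0 : (p < u)%N -> (0 < q)%N.
Proof. by move=> pu; have := qexp_rt n_ge2 u_gt0; have := rtP n_ge2 u; case: (q); lia. Qed.

(** Exponents of single variables and the height separate the four families.
    Since [q_u >= 1], the [phi] involve [x_p], which the [xi] do not; the index
    [u + i] of a [phi] exceeds the index [u - z + j] of a [psi]; and [x_n^v]
    divides no [psi], which exist only for [w > 0]. *)
Lemma Phi_pairs_antichain c c' : (p < u)%N -> c \in Phi_pairs -> c' \in Phi_pairs ->
  (c.1 <= c'.1)%MM -> c = c'.
Proof.
move=> pu cP; move: c cP c'.
have rp := rtP n_ge2 u; have rp' := rtP n_ge2 (u - z); have q0 := qexp_u_gt0 pu.
have uE := qexp_rt n_ge2 u_gt0; have uE' := qexp_rt n_ge2 u'_gt0.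
have hE i : (i <= p)%N -> height n i = i by rewrite /height => ->.
have hn : height n n = 0%N by rewrite /height ifN //; lia.
apply: Phi_pairs_ind => [i ip|j w0 jz jp||i j ij jp];
  apply: Phi_pairs_ind => [i' ip'|j' w0' jz' jp'||i' j' ij' jp'] le //.
- have := mnm_le_entry (r + i) le; rewrite /= !(mnmDE, mulmnE, wtD, wtMn) !var_entry; [|lia..].
  have := wt_le (height n) le; rewrite /= !(mnmDE, mulmnE, wtD, wtMn) !wt_var; [|lia..].
  rewrite !hE; [|lia..] => h e.
  by congr phi_pair; lia.
- have := wt_le (height n) le; rewrite /= !(mnmDE, mulmnE, wtD, wtMn) !wt_var; [|lia..].
  by rewrite hn !hE; lia.
- have := mnm_le_entry p le; rewrite /= !(mnmDE, mulmnE, wtD, wtMn) !var_entry; lia.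
- have := mnm_le_entry p le; rewrite /= !(mnmDE, mulmnE, wtD, wtMn) !var_entry; lia.
- have := mnm_le_entry n le; rewrite /= !(mnmDE, mulmnE, wtD, wtMn) !var_entry; lia.
- have := mnm_le_entry (r' + j) le; rewrite /= !(mnmDE, mulmnE, wtD, wtMn) !var_entry; [|lia..].
  have := wt_le (height n) le; rewrite /= !(mnmDE, mulmnE, wtD, wtMn) !wt_var; [|lia..].
  rewrite hn !hE; [|lia..] => h e.
  by congr psi_pair; lia.
- have := mnm_le_entry (r' + j) le; rewrite /= !(mnmDE, mulmnE, wtD, wtMn) !var_entry; lia.
- have := mnm_le_entry n le; rewrite /= !(mnmDE, mulmnE, wtD, wtMn) !var_entry; lia.
- have := mnm_le_entry n le; rewrite /= !(mnmDE, mulmnE, wtD, wtMn) !var_entry; lia.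
- have := mnm_le_entry n le; rewrite /= !(mnmDE, mulmnE, wtD, wtMn) !var_entry; lia.
- have := mnm_le_entry n le; rewrite /= !(mnmDE, mulmnE, wtD, wtMn) !var_entry; lia.
(* A [xi] has degree 2 in [x_1, ..., x_(p - 1)], the other families at most 1. *)
- have := wt_le (fun k => (0 < k < p)%N : nat) le; rewrite /= !(mnmDE, mulmnE, wtD, wtMn) !wt_var; lia.
- have := wt_le (fun k => (0 < k < p)%N : nat) le; rewrite /= !(mnmDE, mulmnE, wtD, wtMn) !wt_var; lia.
- have := wt_le (fun k => (0 < k < p)%N : nat) le; rewrite /= !(mnmDE, mulmnE, wtD, wtMn) !wt_var; lia.
have := mnm_le_entry i le; have := mnm_le_entry j le.
rewrite /= !(mnmDE, mulmnE, wtD, wtMn) !var_entry; [|lia..] => lej lei.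
by congr xi_pair; lia.
Qed.

Variables (m : nat -> nat) (d : nat).
Hypotheses (m0_gt0 : (0 < m 0)%N) (mn_gt0 : (0 < m n)%N).
Hypothesis m_arith : forall i, (i <= p)%N -> m i = (m 0 + i * d)%N.
Hypotheses (lambda_gt0 : (1 <= lambda)%N) (nu_ge2 : (2 <= nu)%N).
Hypothesis eq_u : wt m (stair n u) = (lambda * m 0 + w * m n)%N.
Hypothesis eq_v : (v * m n)%N = (mu * m 0 + wt m (stair n z))%N.
Hypothesis eq_nu : (wt m (stair n (u - z)) + (v - w) * m n)%N = (nu * m 0)%N.

(** For [lambda = 1] the trailing monomial need not contain [x_0]; then the
    comparison is decided by [x_i], which precedes [x_(r + i)] and [x_p]. *)
Lemma phi_pair_lowering i : (i <= p - r)%N -> lowering m (phi_pair i).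
Proof.
move=> ip; have rp := rtP n_ge2 u.
have wE : wt m (phi_pair i).1 = wt m (phi_pair i).2.
  move: eq_u; rewrite stair_pos // !wtD !wtMn !wt_var; [|lia..].
  rewrite (m_arith (i := r)) ?(m_arith (i := r + i)) ?(m_arith (i := i)); [|lia..].
  by case: (lambda) lambda_gt0 => //= l _; lia.
have [l1|l2] := leqP lambda 1.
  apply: (@lowering_of_entry n m i) => // [|| j ji].
  - by lia.
  - by rewrite !mnmDE !mulmnE !var_entry; lia.
  - by rewrite !mnmDE !mulmnE !var_entry; lia.
apply: (@lowering_of_entry n m 0) => //.
by rewrite !mnmDE !mulmnE !var_entry; lia.
Qed.

Lemma psi_pair_lowering j : (j <= p - r')%N -> lowering m (psi_pair j).
Proof.
move=> jp; have rp := rtP n_ge2 (u - z).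
apply: (@lowering_of_entry n m 0) => //.
  move: eq_nu; rewrite stair_pos // !wtD !wtMn !wt_var; [|lia..].
  rewrite (m_arith (i := r')) ?(m_arith (i := r' + j)) ?(m_arith (i := j)); [|lia..].
  by case: (nu) nu_ge2 => //= l _; lia.
by rewrite !mnmDE !mulmnE !var_entry; lia.
Qed.

(** For [mu = 0] the comparison is decided by [x_(r_z)]; then [z > 0], as
    [v m_n] is positive. *)
Lemma theta_pair_lowering : lowering m theta_pair.
Proof.
have wE : wt m theta_pair.1 = wt m theta_pair.2.
  by rewrite wtD !wtMn !wt_var.
have [mu0|mu0] := posnP mu; last first.
  apply: (@lowering_of_entry n m 0) => //.
  by rewrite !mnmDE !mulmnE !var_entry; lia.
have [z0|z0] := posnP z; first by move: eq_v; rewrite z0 mu0 wt0; nia.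
have rp := rtP n_ge2 z.
apply: (@lowering_of_entry n m (rt p z)) => // [|| j jr]; rewrite ?mu0; first lia.
  by rewrite !mnmDE stair_pos // mnmDE !mulmnE !var_entry; lia.
by rewrite !mnmDE stair_pos // mnmDE !mulmnE !var_entry; lia.
Qed.

Lemma xi_pair_lowering i j : (1 <= i <= j)%N -> (j <= p.-1)%N ->
  lowering m (xi_pair n i j).
Proof.
move=> ij jp; rewrite /xi_pair; case: leqP => ijp.
  apply: (@lowering_of_entry n m 0) => //=; rewrite ?wtD ?wt_var //; try lia.
    by rewrite (m_arith (i := i)) ?(m_arith (i := j)) ?(m_arith (i := i + j)); lia.
  by rewrite !mnmDE !var_entry; lia.
apply: (@lowering_of_entry n m (i + j - p)) => [|||k kp] /=; rewrite ?wtD ?wt_var; try lia.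
- rewrite (m_arith (i := i)) ?(m_arith (i := j)) ?(m_arith (i := i + j - p)) ?(m_arith (i := p)); try lia.
- by rewrite !mnmDE !var_entry; lia.
- by rewrite !mnmDE !var_entry; lia.
Qed.

Lemma Phi_pairs_lowering c : c \in Phi_pairs -> lowering m c.
Proof.
move: c; apply: Phi_pairs_ind => [i ip|j _ _ jp||i j ij jp].
- exact: phi_pair_lowering.
- exact: psi_pair_lowering.
- exact: theta_pair_lowering.
- exact: xi_pair_lowering.
Qed.

End Binomials.

(** * The Groebner basis *)

Theorem theorem3p2 (K : fieldType) (n : nat) (m : nat -> nat)
    (u v w z lambda mu nu : nat)
    (n_ge2 : (2 <= n)%N)
    (m0_gt0 : (0 < m 0)%N)
    (m_incr : forall i : nat, (i < n.-1)%N -> (m i < m i.+1)%N)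
    (m_arith : exists d : nat, forall i : nat, (i <= n.-1)%N -> m i = (m 0 + i * d)%N)
    (mn_gt0 : (0 < m n)%N)
    (m_gcd : (\big[gcdn/0]_(i < n.+1) m i)%N = 1%N)
    (m_min : minimally_generated n m)
    (u_def : is_least (fun t => ~ Sset n m (gseq n.-1 m t)) u)
    (v_def : is_least (fun b => (1 <= b)%N /\ Gamma' n m (b * m n)%N%:Z) v)
    (w_bound : (w <= v - 1)%N)
    (z_bound : (z <= u - 1)%N)
    (lambda_ge1 : (1 <= lambda)%N)
    (nu_ge2 : (2 <= nu)%N)
    (eq_u : gseq n.-1 m u = (lambda * m 0 + w * m n)%N%:Z)
    (eq_v : (v * m n)%N%:Z = (mu * m 0)%N%:Z + gseq n.-1 m z)
    (eq_nu : gseq n.-1 m (u - z) + ((v - w) * m n)%N%:Z = (nu * m 0)%N%:Z)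
    (nu_def : nu = if (rt n.-1 (u - z) < rt n.-1 u)%N
                   then (lambda + mu + 1)%N else (lambda + mu)%N) :
  minimal_groebner_basis (@wgrevlex n.+1 m) (@toric_ideal K n m)
    (Phi K n u v w z lambda mu nu).
Proof.
have [d m_arith'] := m_arith.
have m_gt0 (i : 'I_n.+1) : (0 < m i)%N.
  have [ip|ip] := leqP i n.-1; first by rewrite m_arith' //; lia.
  by rewrite (_ : nat_of_ord i = n) //; have := ltn_ord i; lia.
(* [g_0 = 0] lies in [S], because [- m_0] is negative. *)
have u_gt0 : (0 < u)%N.
  rewrite lt0n; apply/eqP => u0; case: u_def => + _; rewrite u0 stair_wt // wt0; apply.
  split; first by rewrite -(wt0 n.+1 m); apply: Gamma_wt.
  by case=> a; lia.
have w_lt : (w < v)%N by have [[v1 _] _] := v_def; lia.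
have z_lt : (z < u)%N by lia.
have eq_u' : wt m (stair n u) = (lambda * m 0 + w * m n)%N.
  by move: eq_u; rewrite stair_wt // => -[].
have eq_v' : (v * m n = mu * m 0 + wt m (stair n z))%N.
  by move: eq_v; rewrite stair_wt // -PoszD => -[].
have eq_nu' : (wt m (stair n (u - z)) + (v - w) * m n = nu * m 0)%N.
  by move: eq_nu; rewrite stair_wt // -PoszD => -[].
have u_gt_p := lt_p_u n_ge2 m_min u_gt0 eq_u'.
rewrite Phi_binom; refine (@toric_minimal_groebner K n m m_gt0 _ _ _ _).
- exact: (Phi_pairs_lowering n_ge2 w_lt z_lt m0_gt0 mn_gt0 m_arith' lambda_ge1 nu_ge2
    eq_u' eq_v' eq_nu').
- move=> a b /(standard_form n_ge2 w_lt z_lt)[k [t [c [aE tu cv tcW]]]].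
  move=> /(standard_form n_ge2 w_lt z_lt)[k' [s [c' [bE su c'v sc'W]]]] wab.
  suff [ts cc kk] : [/\ t = s, c = c' & k = k'] by rewrite aE bE ts cc kk.
  apply: (box_injective n_ge2 m0_gt0 m_arith' u_def v_def w_lt z_lt eq_u' eq_v'
    tu su cv c'v tcW sc'W).
  by move: wab; rewrite aE bE !wtD !wtMn !wt_var.
- by move=> c c'; apply: Phi_pairs_antichain.
Qed.
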